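(* Let $\mathbb{X}$ be a Cartesian tangent category. If $C$ is a differential curve object in $\mathbb{X}$, then $(C,\gamma^C,u)$ is a commutative differential rig, and any differential bundle $q:A\to M$ is a differential $C$-module with action $\gamma^A:C\times A\to A$.
   Context: Composition is written in diagrammatic order: $fg$ means first $f$, then $g$. A tangent category is a category $\mathbb{X}$ with a functor $T:\mathbb{X}\to\mathbb{X}$ and natural transformations $p:T\to 1$, $0:1\to T$, $+:T_2\to T$, $\ell:T\to T^2$, $c:T^2\to T^2$ such that: (1) for all $M,n$ the fibre power $T_nM$ of $n$ copies of $p_M:TM\to M$ exists and is preserved by every $T^k$; (2) $(p_M,+_M,0_M)$ is an additive bundle, i.e. a commutative monoid in $\mathbb{X}/M$; (3) $(\ell_M,0_M)$ is an additive bundle morphism (commuting square preserving addition and zero) from $(p_M,+_M,0_M)$ to $(T(p_M),T(+_M),T(0_M))$, and $(c_M,1_{TM})$ is one from $(T(p_M),T(+_M),T(0_M))$ to $(p_{TM},+_{TM},0_{TM})$; (4) $cc=1$, $\ell c=\ell$, $\ell T(\ell)=\ell\ell_T$, $T(c)c_TT(c)=c_TT(c)c_T$, $\ell_TT(c)c_T=cT(\ell)$; (5) with $v:=\langle\pi_0\ell,\pi_10_{TM}\rangle T(+):T_2M\to T^2M$, the square $vT(p)=\pi_0p0$ exhibits $T_2M$ as the pullback of $T(p_M)$ along $0_M$, and this pullback is preserved by every $T^k$. It is Cartesian if it has finite products (terminal object $1$, unique maps to it written $!$) and $T$ preserves them; $T(A\times B)$ is identified with $TA\times TB$. Object subscripts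 are often omitted. Differential bundles. A differential bundle $(q:A\to M,\lambda,\sigma,\zeta)$ is an additive bundle $(q,\sigma:A_2\to A,\zeta:M\to A)$ whose fibre powers $A_n$ exist and are preserved by every $T^k$, with a lift $\lambda:A\to TA$ such that $(\lambda,0_M)$ is an additive bundle morphism from $(q,\sigma,\zeta)$ to $(T(q),T(\sigma),T(\zeta))$, $(\lambda,\zeta)$ is one from $(q,\sigma,\zeta)$ to $(p_A,+_A,0_A)$, $\lambda\ell_A=\lambda T(\lambda)$, and, with $\mu:=\langle\pi_00,\pi_1\lambda\rangle T(\sigma):A_2\to TA$, the square $\mu T(q)=\pi_0q0$ exhibits $A_2$ as the pullback of $T(q)$ along $0_M$, preserved by every $T^k$. A bundle morphism $(f,g)$ from $q:A\to M$ to $q':A'\to M'$ is $f:A\to A'$, $g:M\to M'$ with $fq'=qg$; it is linear if $f\lambda'=\lambda T(f)$. If $f:X\to TA$ satisfies $fT(q)=fpq0$, then $\{f\}:X\to A$ denotes the unique map with $\langle fp,\{f\}\rangle\mu=f$. Differential objects. A differential object is a commutative monoid $(A,\sigma,\zeta)$ with a map $\hat p:TA\to A$ such that $(p,\hat p)$ exhibits $TA$ as $A\times A$, $0\hat p=\,!\zeta$, $+\hat p=\langle\pi_0\hat p,\pi_1\hat p\rangle\sigma$, $T(\sigma)\hat p=(\hat p\times\hat p)\sigma$, $T(\zeta)\hat p=\zeta$, $\ell T(\hat p)\hat p=\hat p$. It is a differential bundle over $1$ with lift $\lambda$ determined by $\lambda p=\,!\zeta$, $\lambda\hat p=1_A$.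 Systems and curve objects. A vector field on $M$ is $V:M\to TM$ with $Vp=1_M$. A dynamical system $(M,V,g)$ is a vector field $V$ on $M$ with $g:1\to M$. Given a dynamical system $(C,c_1,c_0)$, a (parameterized) system $(M,V,g)$ is a vector field $V$ on $M$ with $g:X\to M$; a solution is $\gamma:C\times X\to M$ with $\langle !c_0,1\rangle\gamma=g$ and $(c_1\times 0)T(\gamma)=\gamma V$. A curve object is a dynamical system $(C,c_1,c_0)$ such that every system has at most one solution, $c_1T(c_1)c=c_1T(c_1)$, and $(C,c_1,1_C)$ has a solution. $V$ is complete if $(M,V,1_M)$ has a solution (then every $(M,V,g)$ does). A linear vector field on a differential bundle $q:A\to M$ is a pair of vector fields $V^A$ on $A$, $V^M$ on $M$ with $V^AT(q)=qV^M$ and $\lambda T(V^A)=V^AT(\lambda)c$. A curve object satisfies linear completeness if whenever $(V^A,V^M)$ is a linear vector field on a differential bundle and $V^M$ is complete, then $V^A$ is complete. A differential curve object is a curve object $(C,c_1,c_0)$ satisfying linear completeness with a differential object structure $(\hat p,\sigma,\zeta)$ on $C$ such that $c_0=\zeta$ and $c_1\hat p=\,!u$, where $u:=c_0c_1\hat p:1\to C$. Exponentials and actions. For a differential bundle $q:A\to M$ put $\Delta^A:=\langle1,1\rangle\mu:A\to TA$; $(\Delta^A,0_M)$ is a linear vector field and $E^A:C\times A\to A$ denotes the solution of $(A,\Delta^A,1_A)$. With $\lambda_C$ the lift of $C$, define $\gamma^A:=\{(\lambda_C\times 0)T(E^A)\}:C\times A\to A$ (the bracket is defined). In particular, $\gamma^C:C\times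 C\to C$ is this map for $C$ regarded as a differential bundle over $1$. A (commutative) differential rig structure on the differential object $C$ is a commutative monoid structure $(C,\bullet:C\times C\to C,u:1\to C)$ with $\bullet$ linear in each variable, i.e. $(\lambda_C\times 0)T(\bullet)=\bullet\lambda_C=(0\times\lambda_C)T(\bullet)$. That $q:A\to M$ is a differential $C$-module with action $\gamma^A$ means: $\langle !u,1\rangle\gamma^A=1_A$; $(1\times\gamma^A)\gamma^A=(\gamma^C\times1)\gamma^A:C\times C\times A\to A$; and $\gamma^A$ is bilinear, i.e. $(\gamma^A,\pi_1)$ is a linear bundle morphism from the product bundle $1\times q:C\times A\to C\times M$ (lift $0\times\lambda_A$) to $q$, and $(\gamma^A,q)$ is a linear bundle morphism from $\pi_1:C\times A\to A$ (the pullback of the bundle $C\to1$ along $!:A\to 1$, lift $\lambda_C\times0$) to $q$. *)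

(* Defs.v *)
From Stdlib Require Import ClassicalEpsilon.
From mathcomp Require Import ssreflect ssrfun ssrbool eqtype ssrnat fintype.

Set Implicit Arguments.
Unset Strict Implicit.
Unset Printing Implicit Defensive.

Declare Scope cat_scope.
Delimit Scope cat_scope with cat.
Open Scope cat_scope.

Reserved Notation "A ~> B" (at level 99, B at level 200, no associativity).
Reserved Notation "f ;; g" (at level 50, left associativity).

(* Composition is diagrammatic: [f ;; g] is first [f], then [g]. *)
Record Category := {
  obj :> Type;
  hom : obj -> obj -> Type;
  idm : forall A, hom A A;
  comp : forall A B D, hom A B -> hom B D -> hom A D;
  comp1m : forall A B (f : hom A B), comp (idm A) f = f;
  compm1 : forall A B (f : hom A B), comp f (idm B) = f;
  compA : forall A B D E (f : hom A B) (g : hom B D) (h : hom D E),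
    comp f (comp g h) = comp (comp f g) h
}.
Arguments idm {c} A.
Arguments comp {c A B D} f g.

Notation "A ~> B" := (hom A B) : cat_scope.
Notation "f ;; g" := (comp f g) : cat_scope.

Record Functor (X Y : Category) := {
  fobj :> X -> Y;
  fmap : forall A B : X, (A ~> B) -> (fobj A ~> fobj B);
  fmap1 : forall A : X, fmap (idm A) = idm (fobj A);
  fmapM : forall (A B D : X) (f : A ~> B) (g : B ~> D),
    fmap (f ;; g) = fmap f ;; fmap g
}.
Arguments fmap {X Y} f {A B} _ : rename.

Definition idF (X : Category) : Functor X X :=
  {| fobj := fun A => A; fmap := fun _ _ f => f;
     fmap1 := fun _ => erefl; fmapM := fun _ _ _ _ _ => erefl |}.

Program Definition compF (X Y Z : Category) (F : Functor X Y) (G : Functor Y Z) :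
    Functor X Z :=
  {| fobj := fun A => G (F A); fmap := fun _ _ f => fmap G (fmap F f) |}.
Next Obligation. by move=> *; rewrite !fmap1. Qed.
Next Obligation. by move=> *; rewrite !fmapM. Qed.

Fixpoint iterF (X : Category) (F : Functor X X) (k : nat) : Functor X X :=
  if k is k'.+1 then compF F (iterF F k') else idF X.

Section Limits.
Variable X : Category.

Definition IsTerminal (U : X) : Prop :=
  forall Y : X, exists! h : Y ~> U, True.

Definition IsProduct (A B P : X) (p0 : P ~> A) (p1 : P ~> B) : Prop :=
  forall (Y : X) (x : Y ~> A) (y : Y ~> B),
    exists! h : Y ~> P, h ;; p0 = x /\ h ;; p1 = y.

Definition IsPullback (A B M P : X) (f : A ~> M) (g : B ~> M)
    (p0 : P ~> A) (p1 : P ~> B) : Prop :=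
  p0 ;; f = p1 ;; g /\
  forall (Y : X) (x : Y ~> A) (y : Y ~> B), x ;; f = y ;; g ->
    exists! h : Y ~> P, h ;; p0 = x /\ h ;; p1 = y.

(* The [n]-fold power of [q] in the slice over [M]: the wide pullback of [n]
   copies of [q]. The structure map [b] to [M] is only needed for [n = 0]. *)
Definition IsFibrePower (n : nat) (A M P : X) (q : A ~> M)
    (b : P ~> M) (pr : 'I_n -> (P ~> A)) : Prop :=
  (forall i, pr i ;; q = b) /\
  forall (Y : X) (y : Y ~> M) (x : 'I_n -> (Y ~> A)),
    (forall i, x i ;; q = y) ->
    exists! h : Y ~> P, h ;; b = y /\ forall i, h ;; pr i = x i.

Section Lifts.
Variables (A B P : X) (p0 : P ~> A) (p1 : P ~> B).

Definition prod_lift (H : IsProduct p0 p1) (Y : X) (x : Y ~> A) (y : Y ~> B) :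
  Y ~> P := proj1_sig (constructive_indefinite_description _ (H Y x y)).

Lemma prod_lift0 H Y (x : Y ~> A) y : prod_lift H x y ;; p0 = x.
Proof. by rewrite /prod_lift; case: constructive_indefinite_description => h [[]]. Qed.
Lemma prod_lift1 H Y (x : Y ~> A) y : prod_lift H x y ;; p1 = y.
Proof. by rewrite /prod_lift; case: constructive_indefinite_description => h [[]]. Qed.
Lemma prod_ext (H : IsProduct p0 p1) Y (h k : Y ~> P) :
  h ;; p0 = k ;; p0 -> h ;; p1 = k ;; p1 -> h = k.
Proof.
by move=> e0 e1; case: (H Y (k ;; p0) (k ;; p1)) => w [_ u]; rewrite -(u h) // -(u k).
Qed.

Variables (M : X) (f : A ~> M) (g : B ~> M).
Definition pb_lift (H : IsPullback f g p0 p1) (Y : X) (x : Y ~> A) (y : Y ~> B)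
  (e : x ;; f = y ;; g) : Y ~> P :=
  proj1_sig (constructive_indefinite_description _ (proj2 H Y x y e)).

Lemma pb_lift0 H Y (x : Y ~> A) y e : @pb_lift H Y x y e ;; p0 = x.
Proof. by rewrite /pb_lift; case: constructive_indefinite_description => h [[]]. Qed.
Lemma pb_lift1 H Y (x : Y ~> A) y e : @pb_lift H Y x y e ;; p1 = y.
Proof. by rewrite /pb_lift; case: constructive_indefinite_description => h [[]]. Qed.
Lemma pb_ext (H : IsPullback f g p0 p1) Y (h k : Y ~> P) :
  h ;; p0 = k ;; p0 -> h ;; p1 = k ;; p1 -> h = k.
Proof.
move=> e0 e1.
have e : (k ;; p0) ;; f = (k ;; p1) ;; g by rewrite -!compA (proj1 H).
by case: (proj2 H _ _ _ e) => w [_ u]; rewrite -(u h) // -(u k).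
Qed.
End Lifts.
End Limits.

Section Additive.
Variables (X : Category) (T : Functor X X).

(* A pullback preserved by every power of [T]; [k = 0] is the pullback itself. *)
Definition StablePullback (A B M P : X) (f : A ~> M) (g : B ~> M)
    (p0 : P ~> A) (p1 : P ~> B) : Prop :=
  forall k, IsPullback (fmap (iterF T k) f) (fmap (iterF T k) g)
                       (fmap (iterF T k) p0) (fmap (iterF T k) p1).

Definition HasStablePowers (A M : X) (q : A ~> M) : Prop :=
  forall n, exists (P : X) (b : P ~> M) (pr : 'I_n -> (P ~> A)),
    forall k, IsFibrePower (fmap (iterF T k) q) (fmap (iterF T k) b)
                           (fun i => fmap (iterF T k) (pr i)).

(* A chosen second fibre power of [q], preserved by every power of [T]. *)
Record FibreSquare (A M : X) (q : A ~> M) := {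
  fs_obj :> X;
  pr0 : fs_obj ~> A;
  pr1 : fs_obj ~> A;
  fs_stable : StablePullback q q pr0 pr1
}.

Definition fs_pullback (A M : X) (q : A ~> M) (S : FibreSquare q) :
  IsPullback q q (pr0 S) (pr1 S) := fs_stable S 0.

(* The pairing [<x,y>] into a fibre square. It is made total for convenience:
   when [x ;; q <> y ;; q] it takes the irrelevant value [<x,x>]. *)
Definition fpair (A M : X) (q : A ~> M) (S : FibreSquare q) (Y : X)
    (x y : Y ~> A) : Y ~> S :=
  match excluded_middle_informative (x ;; q = y ;; q) with
  | left e => pb_lift (fs_pullback S) e
  | right _ => pb_lift (fs_pullback S) (erefl (x ;; q))
  end.

Definition TSquare (A M : X) (q : A ~> M) (S : FibreSquare q) :
    FibreSquare (fmap T q) :=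
  {| fs_obj := T S; pr0 := fmap T (pr0 S); pr1 := fmap T (pr1 S);
     fs_stable := fun k => fs_stable S k.+1 |}.

Record AddData (A M : X) (q : A ~> M) := {
  sq : FibreSquare q;
  add : sq ~> A;
  zer : M ~> A
}.

Definition TAdd (A M : X) (q : A ~> M) (D : AddData q) : AddData (fmap T q) :=
  {| sq := TSquare (sq D); add := fmap T (add D); zer := fmap T (zer D) |}.

(* Commutative monoid in the slice over [M]; associativity is stated on
   generalized elements of the third fibre power. *)
Record IsAdditiveBundle (A M : X) (q : A ~> M) (D : AddData q) : Prop := {
  add_over : add D ;; q = pr0 (sq D) ;; q;
  zer_over : zer D ;; q = idm M;
  add_zero : fpair (sq D) (q ;; zer D) (idm A) ;; add D = idm A;
  add_comm : fpair (sq D) (pr1 (sq D)) (pr0 (sq D)) ;; add D = add D;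
  add_assoc : forall (Y : X) (x y z : Y ~> A),
    x ;; q = y ;; q -> y ;; q = z ;; q ->
    fpair (sq D) (fpair (sq D) x y ;; add D) z ;; add D =
    fpair (sq D) x (fpair (sq D) y z ;; add D) ;; add D
}.

Record IsAdditiveBundleMorphism (A M : X) (q : A ~> M) (D : AddData q)
    (A' M' : X) (q' : A' ~> M') (D' : AddData q')
    (f : A ~> A') (g : M ~> M') : Prop := {
  abm_square : f ;; q' = q ;; g;
  abm_add : add D ;; f =
            fpair (sq D') (pr0 (sq D) ;; f) (pr1 (sq D) ;; f) ;; add D';
  abm_zero : zer D ;; f = g ;; zer D'
}.

Section PairTheory.
Variables (A M : X) (q : A ~> M) (S : FibreSquare q).
Lemma fpair0 Y (x y : Y ~> A) : x ;; q = y ;; q -> fpair S x y ;; pr0 S = x.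
Proof.
by rewrite /fpair; case: excluded_middle_informative => // e _; rewrite pb_lift0.
Qed.
Lemma fpair1 Y (x y : Y ~> A) : x ;; q = y ;; q -> fpair S x y ;; pr1 S = y.
Proof.
by rewrite /fpair; case: excluded_middle_informative => // e _; rewrite pb_lift1.
Qed.
Lemma pr01 : pr0 S ;; q = pr1 S ;; q.
Proof. exact: (proj1 (fs_pullback S)). Qed.
Lemma fs_ext Y (h k : Y ~> S) :
  h ;; pr0 S = k ;; pr0 S -> h ;; pr1 S = k ;; pr1 S -> h = k.
Proof. exact: (pb_ext (fs_pullback S)). Qed.
Lemma fpair_eq Y (x y : Y ~> A) (h : Y ~> S) :
  h ;; pr0 S = x -> h ;; pr1 S = y -> fpair S x y = h.
Proof.
move=> <- <-; have e : h ;; pr0 S ;; q = h ;; pr1 S ;; q by rewrite -!compA pr01.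
by apply: fs_ext; rewrite ?fpair0 ?fpair1.
Qed.
Lemma comp_fpair Y Z (h : Z ~> Y) (x y : Y ~> A) : x ;; q = y ;; q ->
  h ;; fpair S x y = fpair S (h ;; x) (h ;; y).
Proof.
by move=> e; apply/esym/fpair_eq; rewrite -compA ?fpair0 ?fpair1.
Qed.
End PairTheory.
End Additive.

Record TangentCategory := {
  tc_cat :> Category;
  T : Functor tc_cat tc_cat;
  p : forall M : tc_cat, T M ~> M;
  (* the additive bundle [(p_M, +_M, 0_M)], with its chosen [T_2 M] *)
  tb : forall M, AddData T (p M);
  ell : forall M, T M ~> T (T M);
  flip : forall M, T (T M) ~> T (T M);
  p_nat : forall M N (f : M ~> N), fmap T f ;; p N = p M ;; f;
  zero_nat : forall M N (f : M ~> N), f ;; zer (tb N) = zer (tb M) ;; fmap T f;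
  plus_nat : forall M N (f : M ~> N),
    fpair (sq (tb N)) (pr0 (sq (tb M)) ;; fmap T f) (pr1 (sq (tb M)) ;; fmap T f)
      ;; add (tb N) = add (tb M) ;; fmap T f;
  ell_nat : forall M N (f : M ~> N),
    fmap T f ;; ell N = ell M ;; fmap T (fmap T f);
  flip_nat : forall M N (f : M ~> N),
    fmap T (fmap T f) ;; flip N = flip M ;; fmap T (fmap T f);
  p_powers : forall M, HasStablePowers T (p M);
  p_additive : forall M, IsAdditiveBundle (tb M);
  ell_additive : forall M,
    IsAdditiveBundleMorphism (tb M) (TAdd (tb M)) (ell M) (zer (tb M));
  flip_additive : forall M,
    IsAdditiveBundleMorphism (TAdd (tb M)) (tb (T M)) (flip M) (idm (T M));
  flip_flip : forall M, flip M ;; flip M = idm (T (T M));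
  ell_flip : forall M, ell M ;; flip M = ell M;
  ell_ell : forall M, ell M ;; fmap T (ell M) = ell M ;; ell (T M);
  flip_braid : forall M, fmap T (flip M) ;; flip (T M) ;; fmap T (flip M)
                      = flip (T M) ;; fmap T (flip M) ;; flip (T M);
  ell_flip_flip : forall M,
    ell (T M) ;; fmap T (flip M) ;; flip (T M) = flip M ;; fmap T (ell M);
  vertical_lift_universal : forall M,
    let T2M := sq (tb M) in
    let v := fpair (TSquare T2M) (pr0 T2M ;; ell M) (pr1 T2M ;; zer (tb (T M)))
               ;; fmap T (add (tb M)) in
    StablePullback T (fmap T (p M)) (zer (tb M)) v (pr0 T2M ;; p M)
}.
Arguments T {t}.
Arguments p {t} M.
Arguments tb {t} M.
Arguments ell {t} M.
Arguments flip {t} M.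

Notation Tm := (fmap T).
Notation T_2 M := (sq (tb M)).
Notation plus M := (add (tb M)).
Notation zero M := (zer (tb M)).

Record CartesianTangentCategory := {
  ctc :> TangentCategory;
  one : ctc;
  cprod : ctc -> ctc -> ctc;
  cfst : forall A B, cprod A B ~> A;
  csnd : forall A B, cprod A B ~> B;
  one_terminal : IsTerminal one;
  prod_product : forall A B, IsProduct (cfst A B) (csnd A B);
  T_one : IsTerminal (T one);
  T_prod : forall A B, IsProduct (Tm (cfst A B)) (Tm (csnd A B))
}.
Arguments one {c} : rename.
Arguments cprod {c} A B : rename.
Arguments cfst {c A B} : rename.
Arguments csnd {c A B} : rename.
Arguments prod_product {c} A B : rename.
Arguments T_prod {c} A B : rename.

Notation "A ** B" := (cprod A B) (at level 40, left associativity) : cat_scope.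

Section Products.
Variable X : CartesianTangentCategory.

Definition bang (Y : X) : Y ~> one :=
  proj1_sig (constructive_indefinite_description _ (@one_terminal X Y)).
Definition ppair (A B Y : X) (x : Y ~> A) (y : Y ~> B) : Y ~> A ** B :=
  prod_lift (prod_product A B) x y.
Definition pmap (A B A' B' : X) (f : A ~> A') (g : B ~> B') : A ** B ~> A' ** B' :=
  ppair (cfst ;; f) (csnd ;; g).
(* [f * g], followed by the identification of [T A' * T B'] with [T (A' * B')] *)
Definition tpmap (A B A' B' : X) (f : A ~> T A') (g : B ~> T B') :
    A ** B ~> T (A' ** B') :=
  prod_lift (T_prod A' B') (cfst ;; f) (csnd ;; g).
Definition passoc (A B D : X) : A ** (B ** D) ~> (A ** B) ** D :=
  ppair (ppair cfst (csnd ;; cfst)) (csnd ;; csnd).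
Definition pswap (A B : X) : A ** B ~> B ** A := ppair csnd cfst.

Record IsCommutativeMonoid (A : X) (m : A ** A ~> A) (e : one ~> A) : Prop := {
  cm_unit : ppair (bang A ;; e) (idm A) ;; m = idm A;
  cm_comm : pswap A A ;; m = m;
  cm_assoc : passoc A A A ;; pmap m (idm A) ;; m = pmap (idm A) m ;; m
}.
End Products.
Arguments bang {X} Y.
Arguments passoc {X} A B D.
Arguments pswap {X} A B.

Section DifferentialBundles.
Variable X : TangentCategory.

Definition mu (A M : X) (q : A ~> M) (D : AddData T q) (l : A ~> T A) :
    sq D ~> T A :=
  fpair (TSquare (sq D)) (pr0 (sq D) ;; zero A) (pr1 (sq D) ;; l) ;; Tm (add D).

Record DifferentialBundle (A M : X) (q : A ~> M) := {
  db_add :> AddData T q;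
  db_lift : A ~> T A;
  db_additive : IsAdditiveBundle db_add;
  db_powers : HasStablePowers T q;
  db_lift_T : IsAdditiveBundleMorphism db_add (TAdd db_add) db_lift (zero M);
  db_lift_p : IsAdditiveBundleMorphism db_add (tb A) db_lift (zer db_add);
  db_lift_lift : db_lift ;; ell A = db_lift ;; Tm db_lift;
  db_universal : StablePullback T (Tm q) (zero M)
                   (mu db_add db_lift) (pr0 (sq db_add) ;; q)
}.

(* Only the projections and the lifts of the two bundles enter the definition,
   so product and pullback bundles can be given by these alone. *)
Definition IsLinearBundleMorphism (A M : X) (q : A ~> M) (l : A ~> T A)
    (A' M' : X) (q' : A' ~> M') (l' : A' ~> T A')
    (f : A ~> A') (g : M ~> M') : Prop :=
  f ;; q' = q ;; g /\ f ;; l' = l ;; Tm f.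

Definition IsVectorField (M : X) (V : M ~> T M) : Prop := V ;; p M = idm M.

Definition IsLinearVectorField (A M : X) (q : A ~> M) (B : DifferentialBundle q)
    (VA : A ~> T A) (VM : M ~> T M) : Prop :=
  [/\ IsVectorField VA, IsVectorField VM, VA ;; Tm q = q ;; VM
    & db_lift B ;; Tm VA = VA ;; Tm (db_lift B) ;; flip A].

Definition Delta (A M : X) (q : A ~> M) (B : DifferentialBundle q) : A ~> T A :=
  fpair (sq B) (idm A) (idm A) ;; mu B (db_lift B).

Section Theory.
Variables (A M : X) (q : A ~> M) (B : DifferentialBundle q).
Notation l := (db_lift B).

Lemma zero_p (N : X) : zero N ;; p N = idm N.
Proof. exact: zer_over (p_additive N). Qed.

Lemma mu_compat : pr0 (sq B) ;; zero A ;; Tm q = pr1 (sq B) ;; l ;; Tm q.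
Proof.
rewrite -!compA (abm_square (db_lift_T B)) -zero_nat !compA.
by rewrite (pr01 (sq B)).
Qed.

Lemma mu_p : mu B l ;; p A = pr0 (sq B).
Proof.
rewrite /mu -compA p_nat compA.
have -> : fpair (TSquare (sq B)) (pr0 (sq B) ;; zero A) (pr1 (sq B) ;; l) ;; p (sq B)
   = pr0 (sq B) ;; fpair (sq B) (idm A) (q ;; zer B).
  have eq1 : idm A ;; q = q ;; zer B ;; q.
    by rewrite -compA (zer_over (db_additive B)) comp1m compm1.
  apply: (@fs_ext _ _ _ _ _ (sq B)).
  - rewrite -!compA -p_nat fpair0 // compm1.
    rewrite compA (@fpair0 _ _ _ _ _ (TSquare (sq B))); last exact: mu_compat.
    by rewrite -compA zero_p compm1.
  - rewrite -!compA -p_nat fpair1 //.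
    rewrite [LHS]compA (@fpair1 _ _ _ _ _ (TSquare (sq B))); last exact: mu_compat.
    by rewrite -compA (abm_square (db_lift_p B)) !compA (pr01 (sq B)).
rewrite -(add_comm (db_additive B)) -compA.
set w := fpair _ (idm A) _.
have -> : w ;; (fpair (sq B) (pr1 (sq B)) (pr0 (sq B)) ;; add B) = idm A.
  rewrite -[RHS](add_zero (db_additive B)) compA; congr comp.
  have eq1 : idm A ;; q = q ;; zer B ;; q.
    by rewrite -compA (zer_over (db_additive B)) comp1m compm1.
  by rewrite comp_fpair ?(pr01 (sq B)) // /w fpair0 // fpair1.
by rewrite compm1.
Qed.

Lemma mu_T_q : mu B l ;; Tm q = pr0 (sq B) ;; q ;; zero M.
Proof. exact: (proj1 (db_universal B 0)). Qed.

(* [{f}] is the unique map with [<f p, {f}> mu = f]. *)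
Definition IsBracket (Y : X) (f : Y ~> T A) (h : Y ~> A) : Prop :=
  f ;; p A ;; q = h ;; q /\ fpair (sq B) (f ;; p A) h ;; mu B l = f.

Lemma bracket_exists (Y : X) (f : Y ~> T A) :
  f ;; Tm q = f ;; p A ;; q ;; zero M -> exists! h : Y ~> A, IsBracket f h.
Proof.
move=> e; have [w [[w0 w1] wu]] := proj2 (db_universal B 0) _ _ _ e.
have w0p : w ;; pr0 (sq B) = f ;; p A by rewrite -w0 /= -compA mu_p.
exists (w ;; pr1 (sq B)); split.
  split; first by rewrite -w1 /= -!compA (pr01 (sq B)).
  by rewrite (@fpair_eq _ _ _ _ _ (sq B) _ _ _ w).
move=> h [hq hm]; rewrite (wu (fpair (sq B) (f ;; p A) h)) ?fpair1 //.
by split=> //=; rewrite compA fpair0.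
Qed.

Definition bracket (Y : X) (f : Y ~> T A)
    (e : f ;; Tm q = f ;; p A ;; q ;; zero M) : Y ~> A :=
  proj1_sig (constructive_indefinite_description _ (bracket_exists e)).

Lemma Delta_linear : IsLinearVectorField B (Delta B) (zero M).
Proof.
have DE : Delta B = fpair (TSquare (sq B)) (zero A) l ;; Tm (add B).
  rewrite /Delta /mu compA comp_fpair; last exact: mu_compat.
  by rewrite !compA fpair0 // fpair1 // !comp1m.
have zl : zero A ;; Tm q = l ;; Tm q.
  by rewrite (abm_square (db_lift_T B)) -zero_nat.
split.
- by rewrite /IsVectorField /Delta -compA mu_p fpair0.
- exact: zero_p.
- by rewrite /Delta -compA mu_T_q !compA fpair0 // comp1m.
rewrite DE fmapM compA.
have T2 := TSquare (TSquare (sq B)).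
have -> : l ;; Tm (fpair (TSquare (sq B)) (zero A) l) =
    fpair (TSquare (TSquare (sq B))) (l ;; Tm (zero A)) (l ;; Tm l).
  apply/esym/(@fpair_eq _ _ _ _ _ (TSquare (TSquare (sq B)))) => /=.
    by rewrite -compA -fmapM (@fpair0 _ _ _ _ _ (TSquare (sq B))).
  by rewrite -compA -fmapM (@fpair1 _ _ _ _ _ (TSquare (sq B))).
rewrite -[X in _ = X ;; flip A]compA -fmapM (abm_add (db_lift_T B)) fmapM /=.
have e2 : pr0 (sq B) ;; l ;; Tm q = pr1 (sq B) ;; l ;; Tm q.
  by rewrite -!compA (abm_square (db_lift_T B)) !compA (pr01 (sq B)).
rewrite compA -[X in _ = X]compA flip_nat compA; congr comp.
apply: (@fpair_eq _ _ _ _ _ (TSquare (TSquare (sq B)))) => /=.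
- rewrite -compA -flip_nat compA -(compA _ _ (Tm (Tm _))) -fmapM.
  rewrite (@fpair0 _ _ _ _ _ (TSquare (sq B))) // fmapM compA.
  rewrite (@fpair0 _ _ _ _ _ (TSquare (sq B))) //.
  rewrite -zero_nat -compA; congr comp.
  by rewrite -(comp1m (zero (T A))) -(abm_zero (flip_additive A)) -compA flip_flip compm1.
- rewrite -compA -flip_nat compA -(compA _ _ (Tm (Tm _))) -fmapM.
  rewrite (@fpair1 _ _ _ _ _ (TSquare (sq B))) // fmapM compA.
  rewrite (@fpair1 _ _ _ _ _ (TSquare (sq B))) //.
  by rewrite -db_lift_lift -compA ell_flip.
Qed.
End Theory.
End DifferentialBundles.

Section DifferentialObjects.
Variable X : CartesianTangentCategory.

(* As [1] and [T 1] are identified, [T_zero_phat] says [T(zeta) phat = zeta];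
   likewise [T (A ** A)] is identified with [T A ** T A] in [T_add_phat]. *)
Record DifferentialStructure (A : X) := {
  phat : T A ~> A;
  do_add : A ** A ~> A;
  do_zero : one ~> A;
  do_monoid : IsCommutativeMonoid do_add do_zero;
  do_product : IsProduct (p A) phat;
  zero_phat : zero A ;; phat = bang A ;; do_zero;
  plus_phat : plus A ;; phat =
    ppair (pr0 (T_2 A) ;; phat) (pr1 (T_2 A) ;; phat) ;; do_add;
  T_add_phat : Tm do_add ;; phat = ppair (Tm cfst ;; phat) (Tm csnd ;; phat) ;; do_add;
  T_zero_phat : Tm do_zero ;; phat = bang (T one) ;; do_zero;
  ell_phat : ell A ;; Tm phat ;; phat = phat
}.

Definition do_lift (A : X) (D : DifferentialStructure A) : A ~> T A :=
  prod_lift (do_product D) (bang A ;; do_zero D) (idm A).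

Lemma terminal_eq (U : X) (H : IsTerminal U) (Y : X) (f g : Y ~> U) : f = g.
Proof. by case: (H Y) => h [_ u]; rewrite -(u f) // -(u g). Qed.

Lemma one_eq (Y : X) (f g : Y ~> one) : f = g.
Proof. exact: (terminal_eq (@one_terminal X)). Qed.

Lemma ppair0 (A B Y : X) (x : Y ~> A) (y : Y ~> B) : ppair x y ;; cfst = x.
Proof. exact: prod_lift0. Qed.
Lemma ppair1 (A B Y : X) (x : Y ~> A) (y : Y ~> B) : ppair x y ;; csnd = y.
Proof. exact: prod_lift1. Qed.
Lemma ppair_ext (A B Y : X) (h k : Y ~> A ** B) :
  h ;; cfst = k ;; cfst -> h ;; csnd = k ;; csnd -> h = k.
Proof. exact: (prod_ext (prod_product A B)). Qed.
Lemma comp_ppair (A B Y Z : X) (h : Z ~> Y) (x : Y ~> A) (y : Y ~> B) :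
  h ;; ppair x y = ppair (h ;; x) (h ;; y).
Proof. by apply: ppair_ext; rewrite -!compA ?ppair0 ?ppair1. Qed.

Lemma ppair_pmap (A B A' B' Y : X) (x : Y ~> A) (y : Y ~> B) (f : A ~> A')
    (g : B ~> B') : ppair x y ;; pmap f g = ppair (x ;; f) (y ;; g).
Proof. by rewrite comp_ppair !compA ppair0 ppair1. Qed.
Lemma ppair_passoc (A B D Y : X) (x : Y ~> A) (y : Y ~> B) (z : Y ~> D) :
  ppair x (ppair y z) ;; passoc A B D = ppair (ppair x y) z.
Proof.
by rewrite /passoc !comp_ppair !compA ppair0 !ppair1 ppair0.
Qed.

Lemma T_terminal (U : X) : IsTerminal U -> IsTerminal (T U).
Proof.
move=> H Y; have [h _] := H one; have [t _] := T_one Y.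
exists (t ;; Tm h); split=> // f _.
have e : Tm (bang U) ;; Tm h = idm (T U).
  by rewrite -fmapM -fmap1; congr fmap; apply: (terminal_eq H).
rewrite -(compm1 f) -e compA; congr comp.
exact: (terminal_eq (@T_one X)).
Qed.

Lemma T_product (A B P : X) (p0 : P ~> A) (p1 : P ~> B) :
  IsProduct p0 p1 -> IsProduct (Tm p0) (Tm p1).
Proof.
move=> H Y x y; pose j := prod_lift H (@cfst X A B) csnd.
have j0 : j ;; p0 = cfst by rewrite prod_lift0.
have j1 : j ;; p1 = csnd by rewrite prod_lift1.
have ij : ppair p0 p1 ;; j = idm P.
  by apply: (prod_ext H); rewrite -compA ?j0 ?j1 ?ppair0 ?ppair1 comp1m.
exists (prod_lift (T_prod A B) x y ;; Tm j); split.
  by rewrite -!compA -!fmapM j0 j1 prod_lift0 prod_lift1.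
move=> h [h0 h1]; rewrite -[RHS]compm1 -fmap1 -ij fmapM compA; congr comp.
apply: (prod_ext (T_prod A B)); rewrite ?prod_lift0 ?prod_lift1 -compA -fmapM.
  by rewrite ppair0.
by rewrite ppair1.
Qed.

Lemma iterT_terminal k (U : X) : IsTerminal U -> IsTerminal (iterF T k U).
Proof. by elim: k U => [//|k IH] U H; apply: IH; apply: T_terminal. Qed.

Lemma iterT_product k (A B P : X) (p0 : P ~> A) (p1 : P ~> B) :
  IsProduct p0 p1 -> IsProduct (fmap (iterF T k) p0) (fmap (iterF T k) p1).
Proof.
elim: k A B P p0 p1 => [//|k IH] A B P p0 p1 H.
by apply: IH; apply: T_product.
Qed.

Lemma one_stable (A : X) :
  StablePullback T (bang A) (bang A) (@cfst X A A) csnd.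
Proof.
move=> k; have t := iterT_terminal k (@one_terminal X).
split; first exact: (terminal_eq t).
by move=> Y x y _; exact: (iterT_product (prod_product A A)).
Qed.

Lemma one_powers (A : X) : HasStablePowers T (bang A).
Proof.
elim=> [|n [P [b [pr H]]]].
  exists one, (idm one), (fun i : 'I_0 => False_rect _ (notF (valP i))) => k.
  have t := iterT_terminal k (@one_terminal X).
  split; first by case.
  move=> Y y x _; exists y; split; last by move=> *; apply: (terminal_eq t).
  by split; [apply: (terminal_eq t)|case].
pose prs (i : 'I_n.+1) : A ** P ~> A :=
  if unlift ord0 i is Some j then csnd ;; pr j else cfst.
have prs0 : prs ord0 = cfst by rewrite /prs unlift_none.
have prsS j : prs (lift ord0 j) = csnd ;; pr j by rewrite /prs liftK.
exists (A ** P), (bang _), prs => k.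
have t := iterT_terminal k (@one_terminal X).
split=> [i|Y y x _]; first exact: (terminal_eq t).
have [_ Hk] := H k.
have [|w [[_ w1] wu]] := Hk Y y (fun j => x (lift ord0 j)).
  by move=> i; apply: (terminal_eq t).
have PH := iterT_product (k := k) (prod_product A P).
exists (prod_lift PH (x ord0) w); split.
  split; first exact: (terminal_eq t).
  move=> i; case: (unliftP ord0 i) => [j|] ->.
    by rewrite prsS fmapM compA prod_lift1.
  by rewrite prs0 prod_lift0.
move=> h [_ hx]; apply: (prod_ext PH).
  by rewrite prod_lift0 -(hx ord0) prs0.
rewrite prod_lift1; apply: wu; split; first exact: (terminal_eq t).
by move=> i; rewrite -(hx (lift ord0 i)) prsS fmapM compA.
Qed.

Section Bundle.
Variables (A : X) (D : DifferentialStructure A).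

Definition do_square : FibreSquare T (bang A) :=
  {| fs_obj := A ** A; pr0 := cfst; pr1 := csnd; fs_stable := @one_stable A |}.

Definition do_data : AddData T (bang A) :=
  {| sq := do_square; add := do_add D; zer := do_zero D |}.

Lemma do_fpair (Y : X) (x y : Y ~> A) : fpair do_square x y = ppair x y.
Proof. by apply: fpair_eq; rewrite /= ?ppair0 ?ppair1. Qed.

Lemma phat_ext (Y : X) (h k : Y ~> T A) :
  h ;; p A = k ;; p A -> h ;; phat D = k ;; phat D -> h = k.
Proof. exact: (prod_ext (do_product D)). Qed.

Lemma lift_p : do_lift D ;; p A = bang A ;; do_zero D.
Proof. exact: prod_lift0. Qed.
Lemma lift_phat : do_lift D ;; phat D = idm A.
Proof. exact: prod_lift1. Qed.

Lemma do_zero_add (Y : X) (z : Y ~> one) (y : Y ~> A) :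
  ppair (z ;; do_zero D) y ;; do_add D = y.
Proof.
rewrite -[RHS]compm1 -(cm_unit (do_monoid D)) compA comp_ppair compm1.
by rewrite !compA (one_eq (y ;; bang A) z).
Qed.

Lemma do_add_comm (Y : X) (x y : Y ~> A) :
  ppair x y ;; do_add D = ppair y x ;; do_add D.
Proof.
by rewrite -[in LHS](cm_comm (do_monoid D)) compA comp_ppair ppair0 ppair1.
Qed.

Lemma do_add_assoc (Y : X) (x y z : Y ~> A) :
  ppair (ppair x y ;; do_add D) z ;; do_add D =
  ppair x (ppair y z ;; do_add D) ;; do_add D.
Proof.
have := congr1 (fun f => ppair x (ppair y z) ;; f) (cm_assoc (do_monoid D)).
rewrite !compA ppair_passoc !ppair_pmap !compm1 => ->.
by [].
Qed.

Lemma do_additive : IsAdditiveBundle do_data.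
Proof.
split=> /=; try exact: one_eq.
- by rewrite do_fpair do_zero_add.
- by rewrite do_fpair; apply: (cm_comm (do_monoid D)).
- by move=> Y x y z _ _; rewrite !do_fpair do_add_assoc.
Qed.

Lemma T_one_eq (Y : X) (f g : Y ~> T one) : f = g.
Proof. exact: (terminal_eq (@T_one X)). Qed.

Lemma tpair0 (Y : X) (x y : Y ~> T A) :
  fpair (TSquare do_square) x y ;; Tm cfst = x.
Proof. by apply: (@fpair0 _ _ _ _ _ (TSquare do_square)); apply: T_one_eq. Qed.
Lemma tpair1 (Y : X) (x y : Y ~> T A) :
  fpair (TSquare do_square) x y ;; Tm csnd = y.
Proof. by apply: (@fpair1 _ _ _ _ _ (TSquare do_square)); apply: T_one_eq. Qed.

Lemma tpair_p (Y : X) (x y : Y ~> T A) :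
  fpair (TSquare do_square) x y ;; Tm (do_add D) ;; p A =
  ppair (x ;; p A) (y ;; p A) ;; do_add D.
Proof.
rewrite -compA p_nat compA; congr comp; apply: ppair_ext.
  by rewrite -compA -p_nat compA tpair0 ppair0.
by rewrite -compA -p_nat compA tpair1 ppair1.
Qed.
Lemma tpair_phat (Y : X) (x y : Y ~> T A) :
  fpair (TSquare do_square) x y ;; Tm (do_add D) ;; phat D =
  ppair (x ;; phat D) (y ;; phat D) ;; do_add D.
Proof. by rewrite -compA T_add_phat compA comp_ppair !compA tpair0 tpair1. Qed.

Lemma do_lift_T : IsAdditiveBundleMorphism do_data (TAdd do_data) (do_lift D) (zero one).
Proof.
split=> /=; first exact: T_one_eq.
- apply: phat_ext.
    rewrite tpair_p -!compA lift_p !compA do_zero_add.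
    by congr comp; apply: one_eq.
  rewrite tpair_phat -!compA lift_phat !compm1.
  by rewrite -[LHS]comp1m; congr comp; apply: ppair_ext; rewrite ?ppair0 ?ppair1 comp1m.
- apply: phat_ext.
    rewrite -!compA lift_p p_nat !compA; congr comp; exact: one_eq.
  rewrite -!compA lift_phat T_zero_phat compm1 compA.
  by rewrite (one_eq (zero one ;; _) (idm one)) comp1m.
Qed.

Lemma do_lift_p : IsAdditiveBundleMorphism do_data (tb A) (do_lift D) (do_zero D).
Proof.
have e : cfst ;; do_lift D ;; p A = csnd ;; do_lift D ;; p A.
  by rewrite -!compA lift_p !compA; congr comp; apply: one_eq.
split=> /=; first exact: lift_p.
- apply: phat_ext.
    rewrite -!compA lift_p (add_over (p_additive A)) !compA fpair0 //.
    by rewrite -[RHS]compA lift_p compA; congr comp; apply: one_eq.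
  rewrite -!compA lift_phat plus_phat compA comp_ppair !compA fpair0 // fpair1 //.
  rewrite -!compA lift_phat !compm1 -[LHS]comp1m; congr comp.
  by apply: ppair_ext; rewrite ?ppair0 ?ppair1 comp1m.
- apply: phat_ext; rewrite -!compA.
    rewrite lift_p zero_p compm1 compA -[RHS]comp1m; congr comp; exact: one_eq.
  rewrite lift_phat zero_phat compm1 compA -[LHS]comp1m; congr comp; exact: one_eq.
Qed.

Lemma do_lift_lift : do_lift D ;; ell A = do_lift D ;; Tm (do_lift D).
Proof.
have ellp : ell A ;; p (T A) = p A ;; zero A.
  rewrite -(abm_square (ell_additive A)) -[in LHS]ell_flip -[LHS]compA.
  by rewrite (abm_square (flip_additive A)) compm1.
apply: (prod_ext (T_product (do_product D))).
- rewrite -!compA (abm_square (ell_additive A)) -fmapM lift_p fmapM.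
  rewrite !compA lift_p -compA zero_nat compA; congr comp; exact: T_one_eq.
- apply: phat_ext.
    rewrite -!compA p_nat (compA (ell A)) ellp (compA (Tm _)) p_nat.
    rewrite -!compA lift_phat compm1 zero_phat !compA lift_p.
    by congr comp; apply: one_eq.
  rewrite -!compA [in LHS](compA (ell A)) ell_phat.
  by rewrite (compA (Tm _)) -fmapM lift_phat fmap1 comp1m lift_phat.
Qed.

Lemma do_universal : StablePullback T (Tm (bang A)) (zero one)
  (mu do_data (do_lift D)) (cfst ;; bang A).
Proof.
pose nu := ppair (p A) (phat D).
have mp : mu do_data (do_lift D) ;; p A = cfst.
  rewrite /mu tpair_p /= -!compA lift_p zero_p compm1 do_add_comm compA.
  by rewrite do_zero_add.
have mh : mu do_data (do_lift D) ;; phat D = csnd.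
  by rewrite /mu tpair_phat /= -!compA lift_phat zero_phat !compA do_zero_add compm1.
have mn : mu do_data (do_lift D) ;; nu = idm (A ** A).
  by apply: ppair_ext; rewrite -compA ?ppair0 ?ppair1 comp1m.
have nm : nu ;; mu do_data (do_lift D) = idm (T A).
  by apply: phat_ext; rewrite -compA ?mp ?mh ?ppair0 ?ppair1 comp1m.
move=> k.
have t1 := iterT_terminal k (@one_terminal X).
have t2 := iterT_terminal k (@T_one X).
split; first exact: (terminal_eq t2).
move=> Y x y _; exists (x ;; fmap (iterF T k) nu); split.
  split; last exact: (terminal_eq t1).
  by rewrite -compA -fmapM nm fmap1 compm1.
by move=> h [<- _]; rewrite -compA -fmapM mn fmap1 compm1.
Qed.

Definition do_bundle : DifferentialBundle (bang A) :=
  {| db_add := do_data; db_lift := do_lift D; db_additive := do_additive;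
     db_powers := @one_powers A; db_lift_T := do_lift_T; db_lift_p := do_lift_p;
     db_lift_lift := do_lift_lift; db_universal := do_universal |}.
End Bundle.
End DifferentialObjects.

Section Curves.
Variable X : CartesianTangentCategory.

Definition IsSolution (C : X) (c1 : C ~> T C) (c0 : one ~> C)
    (M Y : X) (V : M ~> T M) (g : Y ~> M) (s : C ** Y ~> M) : Prop :=
  ppair (bang Y ;; c0) (idm Y) ;; s = g /\
  tpmap c1 (zero Y) ;; Tm s = s ;; V.

Record IsCurveObject (C : X) (c1 : C ~> T C) (c0 : one ~> C) : Prop := {
  curve_field : IsVectorField c1;
  curve_unique : forall (M Y : X) (V : M ~> T M) (g : Y ~> M), IsVectorField V ->
    forall s s' : C ** Y ~> M,
      IsSolution c1 c0 V g s -> IsSolution c1 c0 V g s' -> s = s';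
  curve_flip : c1 ;; Tm c1 ;; flip C = c1 ;; Tm c1;
  curve_solution : exists s, IsSolution c1 c0 c1 (idm C) s
}.

Definition IsComplete (C : X) (c1 : C ~> T C) (c0 : one ~> C)
    (M : X) (V : M ~> T M) : Prop :=
  exists s, IsSolution c1 c0 V (idm M) s.

Definition LinearlyComplete (C : X) (c1 : C ~> T C) (c0 : one ~> C) : Prop :=
  forall (A M : X) (q : A ~> M) (B : DifferentialBundle q)
    (VA : A ~> T A) (VM : M ~> T M),
    IsLinearVectorField B VA VM -> IsComplete c1 c0 VM -> IsComplete c1 c0 VA.

Record DifferentialCurveObject := {
  dco_obj :> X;
  c1 : dco_obj ~> T dco_obj;
  c0 : one ~> dco_obj;
  dco_curve : IsCurveObject c1 c0;
  dco_linear : LinearlyComplete c1 c0;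
  dco_diff : DifferentialStructure dco_obj;
  dco_zero : c0 = do_zero dco_diff;
  dco_unit : c1 ;; phat dco_diff = bang dco_obj ;; (c0 ;; c1 ;; phat dco_diff)
}.

Section Exponentials.
Variable C : DifferentialCurveObject.

Definition unit : one ~> C := c0 C ;; c1 C ;; phat (dco_diff C).
Definition lambdaC : C ~> T C := do_lift (dco_diff C).
Definition bundleC : DifferentialBundle (bang C) := do_bundle (dco_diff C).

Lemma zero_complete (M : X) : IsComplete (c1 C) (c0 C) (zero M).
Proof.
exists csnd; split; first by rewrite ppair1.
by rewrite /tpmap prod_lift1.
Qed.

Section Action.
Variables (A M : X) (q : A ~> M) (B : DifferentialBundle q).

Lemma exp_exists : IsComplete (c1 C) (c0 C) (Delta B).
Proof. exact: dco_linear (Delta_linear B) (zero_complete M). Qed.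

(* the exponential [E^A]; it is unique by [curve_unique] *)
Definition Exp : C ** A ~> A :=
  proj1_sig (constructive_indefinite_description _ exp_exists).

Lemma Exp_solution : IsSolution (c1 C) (c0 C) (Delta B) (idm A) Exp.
Proof. exact: proj2_sig. Qed.

Lemma Exp_q : Exp ;; q = csnd ;; q.
Proof.
have [E0 E1] := Exp_solution.
apply: (curve_unique (dco_curve C) (zero_p M) (g := q)); split.
- by rewrite compA E0 comp1m.
- rewrite fmapM compA E1 -!(compA (Exp)); congr comp.
  by have [_ _ e _] := Delta_linear B; rewrite e.
- by rewrite compA ppair1 comp1m.
- by rewrite fmapM compA /tpmap prod_lift1 -!compA zero_nat.
Qed.

Lemma action_bracket :
  let f := tpmap lambdaC (zero A) ;; Tm Exp in
  f ;; Tm q = f ;; p A ;; q ;; zero M.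
Proof.
rewrite /=; have: tpmap lambdaC (zero A) ;; Tm csnd = csnd ;; zero A.
  exact: prod_lift1.
move: (tpmap _ _) => t ht.
have tp : t ;; p (C ** A) ;; csnd = csnd.
  by rewrite -compA -p_nat compA ht -compA zero_p compm1.
have -> : t ;; Tm Exp ;; Tm q = csnd ;; q ;; zero M.
  by rewrite -compA -fmapM Exp_q fmapM compA ht -!compA zero_nat.
congr (_ ;; _); rewrite -(compA t) p_nat (compA t) -(compA (t ;; _)) Exp_q.
by rewrite compA tp.
Qed.

(* [gamma^A = {(lambda_C * 0) T(E^A)}] *)
Definition action : C ** A ~> A := bracket B action_bracket.
End Action.
End Exponentials.

Section RigsAndModules.
Variables (C : X) (l : C ~> T C).

Record IsCommutativeDifferentialRig (m : C ** C ~> C) (u : one ~> C) : Prop := {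
  rig_monoid : IsCommutativeMonoid m u;
  rig_linear0 : tpmap l (zero C) ;; Tm m = m ;; l;
  rig_linear1 : tpmap (zero C) l ;; Tm m = m ;; l
}.

(* [q] is a differential module over [C] with action [a], where [m] and [u] are
   the multiplication and the unit of [C]. *)
Record IsDifferentialModule (m : C ** C ~> C) (u : one ~> C)
    (A M : X) (q : A ~> M) (B : DifferentialBundle q) (a : C ** A ~> A) : Prop := {
  module_unit : ppair (bang A ;; u) (idm A) ;; a = idm A;
  module_assoc : pmap (idm C) a ;; a = passoc C C A ;; pmap m (idm A) ;; a;
  module_linear0 : IsLinearBundleMorphism (pmap (idm C) q) (tpmap (zero C) (db_lift B))
                     q (db_lift B) a csnd;
  module_linear1 : IsLinearBundleMorphism csnd (tpmap l (zero A)) q (db_lift B) a q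
}.
End RigsAndModules.
End Curves.

(* Main.v *)
From Stdlib Require Import ClassicalEpsilon.
From mathcomp Require Import ssreflect ssrfun ssrbool.
Require Import Defs.

Set Implicit Arguments.
Unset Strict Implicit.
Unset Printing Implicit Defensive.

(** The mechanism is that [gamma^A(t, a)] is the derivative of the exponential
    [s |-> e^s a] at [s = 0] in the direction [t], that is, the scalar multiple
    [t a].

    The bracket defining [gamma^A] amounts to the equation
    [<pi_1, gamma^A> mu = (lambda_C * 0) T(E^A)] ([action_mu]). The derivative
    of the exponential at time [c_0] in the direction [u] is [Delta^A], so [u]
    acts as the identity ([action_unit]). Both linearity statements are proved
    after composition with [T(mu)], which is monic because the universal square
    of a differential bundle is preserved by [T]. Linearity in [C] then comes
    from [lambda ell = lambda T(lambda)] ([action_linear_left]), and linearity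
    in [A] from the linearity of [E^A], which holds because both sides of
    [(0 * lambda) T(E^A) = E^A lambda] solve the same system
    ([action_linear_right]).

    All remaining identities follow from one uniqueness principle
    ([linear_left_unique]): a map [f : C * Y -> A] which is linear in [C] is
    determined, over a given map [Y -> M], by its value [h] at [u]. Indeed
    linear maps are additive, so [f] starts at zero and moves at the constant
    velocity [h]. Thus [<f, pi_1 h>] solves the system on [A_2] given by the
    vector field with value [b] in the first variable and zero in the second at
    [(a, b)], and by the initial value [<zeta, h>]; solutions are unique. In the
    associative law both sides are linear in the first variable and agree at
    [u]. The same principle gives [t * u = t], both sides being linear in [t]
    and equal to [u] at [u]; with this, [s * t] and [t * s] are both linear in
    [s] and agree at [s = u]. *)

(** * Zero, flip and addition in a tangent category *)

Section TangentLemmas.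
Variable X : TangentCategory.

Lemma flip_p (M : X) : flip M ;; p (T M) = Tm (p M).
Proof. by rewrite (abm_square (flip_additive M)) compm1. Qed.

Lemma zero_flip (M : X) : zero (T M) ;; flip M = Tm (zero M).
Proof.
have e : Tm (zero M) ;; flip M = zero (T M).
  by rewrite (abm_zero (flip_additive M)) comp1m.
by rewrite -e -compA flip_flip compm1.
Qed.

Lemma zero_interchange (N M : X) (x : N ~> T M) :
  zero N ;; Tm x ;; flip M = x ;; Tm (zero M).
Proof. by rewrite -zero_nat -compA zero_flip. Qed.

Lemma interchange_zero (N M : X) (x : N ~> T M) :
  x ;; Tm (zero M) ;; flip M = zero N ;; Tm x.
Proof. by rewrite -zero_interchange -compA flip_flip compm1. Qed.

Lemma zero_add_zero (M Y : X) (y : Y ~> M) :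
  fpair (T_2 M) (y ;; zero M) (y ;; zero M) ;; plus M = y ;; zero M.
Proof.
have e : p M ;; zero M ;; p M = idm (T M) ;; p M.
  by rewrite -compA zero_p comp1m compm1.
rewrite -[RHS]compm1 -(add_zero (p_additive M)) compA comp_fpair //.
by rewrite compm1 !compA -(compA y) zero_p compm1.
Qed.

Lemma fpair_plus_nat (M N Y : X) (f : M ~> N) (x y : Y ~> T M) :
  x ;; p M = y ;; p M ->
  fpair (T_2 M) x y ;; plus M ;; Tm f =
  fpair (T_2 N) (x ;; Tm f) (y ;; Tm f) ;; plus N.
Proof.
move=> e; rewrite -compA -plus_nat compA comp_fpair.
  by rewrite !compA fpair0 // fpair1.
by rewrite -!compA !p_nat !compA (pr01 (T_2 M)).
Qed.

Lemma comp_T_fpair (A M Y Z : X) (q : A ~> M) (S : FibreSquare T q)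
    (h : Z ~> T Y) (x y : Y ~> A) : x ;; q = y ;; q ->
  h ;; Tm (fpair S x y) = fpair (TSquare S) (h ;; Tm x) (h ;; Tm y).
Proof.
move=> e; apply/esym/(fpair_eq (S := TSquare S)) => /=.
  by rewrite -compA -fmapM fpair0.
by rewrite -compA -fmapM fpair1.
Qed.

(** * Differential bundles *)

Section Bundle.
Variables (A M : X) (q : A ~> M) (B : DifferentialBundle q).
Notation l := (db_lift B).

Lemma Tfpair0 Y (x y : Y ~> T A) : x ;; Tm q = y ;; Tm q ->
  fpair (TSquare (sq B)) x y ;; Tm (pr0 (sq B)) = x.
Proof. exact: (@fpair0 _ _ _ _ _ (TSquare (sq B))). Qed.

Lemma Tfpair1 Y (x y : Y ~> T A) : x ;; Tm q = y ;; Tm q ->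
  fpair (TSquare (sq B)) x y ;; Tm (pr1 (sq B)) = y.
Proof. exact: (@fpair1 _ _ _ _ _ (TSquare (sq B))). Qed.

Lemma Tfs_ext Y (h k : Y ~> T (sq B)) :
  h ;; Tm (pr0 (sq B)) = k ;; Tm (pr0 (sq B)) ->
  h ;; Tm (pr1 (sq B)) = k ;; Tm (pr1 (sq B)) -> h = k.
Proof. exact: (@fs_ext _ _ _ _ _ (TSquare (sq B))). Qed.

Lemma lift_q : l ;; Tm q = q ;; zero M.
Proof. exact: (abm_square (db_lift_T B)). Qed.

Lemma lift_p_zero : l ;; p A = q ;; zer B.
Proof. exact: (abm_square (db_lift_p B)). Qed.

Lemma fpair_mu_compat Y (x y : Y ~> A) : x ;; q = y ;; q ->
  x ;; zero A ;; Tm q = y ;; l ;; Tm q.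
Proof. by move=> e; rewrite -!compA lift_q -zero_nat !compA e. Qed.

Lemma fpair_mu Y (x y : Y ~> A) : x ;; q = y ;; q ->
  fpair (sq B) x y ;; mu B l =
  fpair (TSquare (sq B)) (x ;; zero A) (y ;; l) ;; Tm (add B).
Proof.
move=> e; rewrite /mu compA (comp_fpair (TSquare (sq B))).
  by rewrite !compA fpair0 // fpair1.
exact: mu_compat.
Qed.

Lemma fpair_mu_inj Y (a b b' : Y ~> A) : a ;; q = b ;; q -> a ;; q = b' ;; q ->
  fpair (sq B) a b ;; mu B l = fpair (sq B) a b' ;; mu B l -> b = b'.
Proof.
move=> e e' H.
have : fpair (sq B) a b = fpair (sq B) a b'.
  by apply: (pb_ext (db_universal B 0)) => //=; rewrite !compA !fpair0.
by move/(congr1 (fun w => w ;; pr1 (sq B))); rewrite !fpair1.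
Qed.

(** The map [T mu] is injective in its second variable, as the universal square
    of the bundle is preserved by [T]. *)
Lemma Tfpair_mu_inj Y (a b b' : Y ~> T A) :
  a ;; Tm q = b ;; Tm q -> a ;; Tm q = b' ;; Tm q ->
  fpair (TSquare (sq B)) a b ;; Tm (mu B l) =
  fpair (TSquare (sq B)) a b' ;; Tm (mu B l) -> b = b'.
Proof.
move=> e e' H.
have : fpair (TSquare (sq B)) a b = fpair (TSquare (sq B)) a b'.
  by apply: (pb_ext (db_universal B 1)) => //=; rewrite fmapM !compA !Tfpair0.
by move/(congr1 (fun w => w ;; Tm (pr1 (sq B)))); rewrite !Tfpair1.
Qed.

Lemma Tfpair_Tmu Y (a b : Y ~> T A) : a ;; Tm q = b ;; Tm q ->
  fpair (TSquare (sq B)) a b ;; Tm (mu B l) =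
  fpair (TSquare (TSquare (sq B))) (a ;; Tm (zero A)) (b ;; Tm l)
    ;; Tm (Tm (add B)).
Proof.
move=> e; rewrite /mu fmapM compA; congr comp.
apply/esym/(fpair_eq (S := TSquare (TSquare (sq B)))) => /=.
  rewrite -compA -fmapM Tfpair0; last exact: mu_compat.
  by rewrite fmapM compA Tfpair0.
rewrite -compA -fmapM Tfpair1; last exact: mu_compat.
by rewrite fmapM compA Tfpair1.
Qed.

(** The lift of a differential bundle is monic: it is [mu] restricted to the
    zero section in the first variable. *)
Lemma lift_mono Y (x y : Y ~> A) : x ;; l = y ;; l -> x = y.
Proof.
move=> e.
have eq : x ;; q = y ;; q.
  have := congr1 (fun w => w ;; p A ;; q) e.
  by rewrite -!compA (compA l) lift_p_zero -compA (zer_over (db_additive B)) compm1.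
have zx : x ;; q ;; zer B ;; q = x ;; q.
  by rewrite -(compA _ (zer B)) (zer_over (db_additive B)) compm1.
have zy : x ;; q ;; zer B ;; q = y ;; q by rewrite zx.
by apply: (fpair_mu_inj zx zy); rewrite !fpair_mu // e.
Qed.

Lemma fpair_add_lift Y (x y : Y ~> A) : x ;; q = y ;; q ->
  fpair (sq B) x y ;; add B ;; l = fpair (T_2 A) (x ;; l) (y ;; l) ;; plus A.
Proof.
move=> e; rewrite -compA (abm_add (db_lift_p B)) compA comp_fpair.
  by rewrite !compA fpair0 // fpair1.
by rewrite -!compA lift_p_zero !compA (pr01 (sq B)).
Qed.

(** The two lemmas below say how [mu] meets [T(lambda) c] and [ell]. They give
    linearity of the action in its second and in its first variable. *)
Lemma fpair_mu_T_lift_flip Y (x y : Y ~> A) : x ;; q = y ;; q ->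
  fpair (sq B) x y ;; mu B l ;; Tm l ;; flip A =
  fpair (TSquare (sq B)) (x ;; l) (y ;; l) ;; Tm (mu B l).
Proof.
move=> e.
have el : x ;; l ;; Tm q = y ;; l ;; Tm q by rewrite -!compA lift_q !compA e.
have ec := fpair_mu_compat e.
have ec2 : pr0 (sq B) ;; l ;; Tm q = pr1 (sq B) ;; l ;; Tm q.
  by rewrite -!compA lift_q !compA (pr01 (sq B)).
rewrite Tfpair_Tmu // fpair_mu // -(compA _ (Tm (add B))) -fmapM.
rewrite (abm_add (db_lift_T B)) /= fmapM !compA -(compA _ (Tm (Tm _))) flip_nat.
rewrite compA; congr comp.
apply/esym/(fpair_eq (S := TSquare (TSquare (sq B)))) => /=.
  rewrite -compA -flip_nat compA -(compA _ (Tm _) (Tm _)) -fmapM.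
  rewrite Tfpair0 // fmapM compA Tfpair0 //.
  by rewrite -!compA (compA (zero A)) zero_interchange.
rewrite -compA -flip_nat compA -(compA _ (Tm _) (Tm _)) -fmapM.
rewrite Tfpair1 // fmapM compA Tfpair1 //.
by rewrite -!compA (compA l) -db_lift_lift -compA ell_flip.
Qed.

Lemma fpair_mu_ell Y (x y : Y ~> A) : x ;; q = y ;; q ->
  fpair (sq B) x y ;; mu B l ;; ell A =
  fpair (TSquare (sq B)) (x ;; zero A) (y ;; l) ;; Tm (mu B l).
Proof.
move=> e; have ec := fpair_mu_compat e.
rewrite Tfpair_Tmu // fpair_mu // -compA ell_nat compA; congr comp.
apply/esym/(fpair_eq (S := TSquare (TSquare (sq B)))) => /=.
  rewrite -compA -ell_nat compA Tfpair0 // -!compA; congr comp.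
  exact: (abm_zero (ell_additive A)).
by rewrite -compA -ell_nat compA Tfpair1 // -!compA db_lift_lift.
Qed.

(** The vector field on [A_2] sending [(a, b)] to [(a + t b, b)], where [t] is
    infinitesimal. *)
Definition translation : sq B ~> T (sq B) :=
  fpair (TSquare (sq B)) (mu B l) (pr1 (sq B) ;; zero A).

Lemma translation_compat : mu B l ;; Tm q = pr1 (sq B) ;; zero A ;; Tm q.
Proof. by rewrite mu_T_q (pr01 (sq B)) -!compA zero_nat. Qed.

Lemma translation_field : IsVectorField translation.
Proof.
apply: (@fs_ext _ _ _ _ _ (sq B)); rewrite comp1m -compA -p_nat compA.
  by rewrite Tfpair0 ?mu_p //; apply: translation_compat.
rewrite Tfpair1; last exact: translation_compat.
by rewrite -compA zero_p compm1.
Qed.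
End Bundle.
End TangentLemmas.

(** * Products and the tangent functor *)

Section CartesianLemmas.
Variable X : CartesianTangentCategory.

(** The pairing of two maps into tangent objects, under the identification of
    [T A * T B] with [T (A * B)]. *)
Definition tpair (A B Y : X) (x : Y ~> T A) (y : Y ~> T B) : Y ~> T (A ** B) :=
  prod_lift (T_prod A B) x y.

Lemma tpair_fst (A B Y : X) (x : Y ~> T A) (y : Y ~> T B) :
  tpair x y ;; Tm cfst = x.
Proof. exact: prod_lift0. Qed.

Lemma tpair_snd (A B Y : X) (x : Y ~> T A) (y : Y ~> T B) :
  tpair x y ;; Tm csnd = y.
Proof. exact: prod_lift1. Qed.

Lemma T_prod_ext (A B Y : X) (h k : Y ~> T (A ** B)) :
  h ;; Tm cfst = k ;; Tm cfst -> h ;; Tm csnd = k ;; Tm csnd -> h = k.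
Proof. exact: (prod_ext (T_prod A B)). Qed.

Lemma TT_prod_ext (A B Y : X) (h k : Y ~> T (T (A ** B))) :
  h ;; Tm (Tm cfst) = k ;; Tm (Tm cfst) ->
  h ;; Tm (Tm csnd) = k ;; Tm (Tm csnd) -> h = k.
Proof. exact: (prod_ext (T_product (T_prod A B))). Qed.

Lemma comp_tpair (A B Y Z : X) (h : Z ~> Y) (x : Y ~> T A) (y : Y ~> T B) :
  h ;; tpair x y = tpair (h ;; x) (h ;; y).
Proof. by apply: T_prod_ext; rewrite -!compA ?tpair_fst ?tpair_snd. Qed.

Lemma ppair_id (A B : X) : ppair cfst csnd = idm (A ** B).
Proof. by apply: ppair_ext; rewrite ?ppair0 ?ppair1 comp1m. Qed.

Lemma tpmapE (A B A' B' : X) (f : A ~> T A') (g : B ~> T B') :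
  tpmap f g = tpair (cfst ;; f) (csnd ;; g).
Proof. by []. Qed.

Lemma ppair_tpmap (A B A' B' Y : X) (x : Y ~> A) (y : Y ~> B)
    (f : A ~> T A') (g : B ~> T B') :
  ppair x y ;; tpmap f g = tpair (x ;; f) (y ;; g).
Proof. by rewrite tpmapE comp_tpair !compA ppair0 ppair1. Qed.

Lemma tpmap_fst (A B A' B' : X) (f : A ~> T A') (g : B ~> T B') :
  tpmap f g ;; Tm cfst = cfst ;; f.
Proof. exact: tpair_fst. Qed.

Lemma tpmap_snd (A B A' B' : X) (f : A ~> T A') (g : B ~> T B') :
  tpmap f g ;; Tm csnd = csnd ;; g.
Proof. exact: tpair_snd. Qed.

Lemma tpair_T_ppair (A B Y Z : X) (h : Y ~> T Z) (x : Z ~> A) (y : Z ~> B) :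
  h ;; Tm (ppair x y) = tpair (h ;; Tm x) (h ;; Tm y).
Proof.
by apply: T_prod_ext; rewrite -compA -fmapM ?ppair0 ?ppair1 ?tpair_fst ?tpair_snd.
Qed.

Lemma tpair_T_pmap (A B A' B' Y : X) (x : Y ~> T A) (y : Y ~> T B)
    (f : A ~> A') (g : B ~> B') :
  tpair x y ;; Tm (pmap f g) = tpair (x ;; Tm f) (y ;; Tm g).
Proof. by rewrite tpair_T_ppair !fmapM !compA tpair_fst tpair_snd. Qed.

Lemma tpair_base (A B Y : X) (x : Y ~> T A) (y : Y ~> T B) :
  tpair x y ;; p (A ** B) = ppair (x ;; p A) (y ;; p B).
Proof.
by apply: ppair_ext; rewrite -compA -p_nat compA
  ?ppair0 ?ppair1 ?tpair_fst ?tpair_snd.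
Qed.

Lemma tpair_zero (A B Y : X) (x : Y ~> A) (y : Y ~> B) :
  tpair (x ;; zero A) (y ;; zero B) = ppair x y ;; zero (A ** B).
Proof.
by apply: T_prod_ext; rewrite -compA -zero_nat compA
  ?ppair0 ?ppair1 ?tpair_fst ?tpair_snd.
Qed.

Lemma tpair_plus (A B Y : X) (x x' : Y ~> T A) (y y' : Y ~> T B) :
  x ;; p A = x' ;; p A -> y ;; p B = y' ;; p B ->
  tpair (fpair (T_2 A) x x' ;; plus A) (fpair (T_2 B) y y' ;; plus B) =
  fpair (T_2 (A ** B)) (tpair x y) (tpair x' y') ;; plus (A ** B).
Proof.
move=> ex ey; have e : tpair x y ;; p (A ** B) = tpair x' y' ;; p (A ** B).
  by rewrite !tpair_base ex ey.
by apply: T_prod_ext; rewrite fpair_plus_nat // ?tpair_fst ?tpair_snd.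
Qed.

(** Tangent vectors in the two factors of a product commute. *)
Lemma tpmap_interchange (A B A' B' : X) (a : A ~> T A') (b : B ~> T B') :
  tpmap (zero A) b ;; Tm (tpmap a (zero B')) ;; flip (A' ** B') =
  tpmap a (zero B) ;; Tm (tpmap (zero A') b).
Proof.
apply: TT_prod_ext; rewrite -(compA _ (flip _)) -flip_nat !compA.
  rewrite -(compA _ (Tm _) (Tm _)) -fmapM tpmap_fst fmapM compA tpmap_fst.
  rewrite -(compA (tpmap a _)) -fmapM tpmap_fst fmapM compA tpmap_fst.
  by rewrite -!compA (compA (zero A)) zero_interchange.
rewrite -(compA _ (Tm _) (Tm _)) -fmapM tpmap_snd fmapM compA tpmap_snd.
rewrite -(compA (tpmap a _)) -fmapM tpmap_snd fmapM compA tpmap_snd.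
by rewrite -!compA (compA b) interchange_zero.
Qed.

Lemma tpmap_ell (A B : X) (a : A ~> T A) : a ;; ell A = a ;; Tm a ->
  tpmap a (zero B) ;; ell (A ** B) = tpmap a (zero B) ;; Tm (tpmap a (zero B)).
Proof.
move=> e; apply: TT_prod_ext; rewrite -compA -ell_nat compA.
  rewrite tpmap_fst -compA e -[RHS]compA -fmapM tpmap_fst fmapM compA.
  by rewrite [RHS]compA tpmap_fst.
rewrite tpmap_snd -compA (abm_zero (ell_additive B)) /= -[RHS]compA -fmapM.
by rewrite tpmap_snd fmapM [RHS]compA tpmap_snd -!compA.
Qed.

(** * Maps linear in their first variable *)

(** A map out of [C * Y] that commutes with the lifts in its first variable. *)
Definition LinearLeft (C Y A : X) (lC : C ~> T C) (lA : A ~> T A)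
    (f : C ** Y ~> A) : Prop := tpmap lC (zero Y) ;; Tm f = f ;; lA.

Section LinearLeftTheory.
Variables (C : X) (D : DifferentialStructure C).
Variables (A M Y : X) (q : A ~> M) (B : DifferentialBundle q).
Variables (f : C ** Y ~> A) (k : Y ~> M).
Hypothesis f_lin : LinearLeft (do_lift D) (db_lift B) f.
Hypothesis f_q : f ;; q = csnd ;; k.

Lemma linear_left_zero :
  ppair (bang Y ;; do_zero D) (idm Y) ;; f = k ;; zer B.
Proof.
set x := _ ;; f.
have xq : x ;; q = k by rewrite /x -compA f_q compA ppair1 comp1m.
(* A point whose lift is a zero tangent vector lies on the zero section. *)
have xl : x ;; db_lift B = x ;; zero A.
  rewrite /x -compA -f_lin compA ppair_tpmap -!compA (abm_zero (do_lift_p D)).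
  by rewrite compA tpair_zero -!compA zero_nat.
move: x xq xl => x xq xl; have := congr1 (fun w => w ;; p A) xl.
by rewrite -!compA zero_p compm1 lift_p_zero compA xq => <-.
Qed.

(** A linear map is additive: compare the sums in [T A], where the lift, which
    is monic, takes them to sums of tangent vectors. *)
Lemma linear_left_add (Z : X) (s t : Z ~> C) (y : Z ~> Y) :
  ppair (ppair s t ;; do_add D) y ;; f =
  fpair (sq B) (ppair s y ;; f) (ppair t y ;; f) ;; add B.
Proof.
have e : ppair s y ;; f ;; q = ppair t y ;; f ;; q.
  by rewrite -!compA f_q !compA !ppair1.
have lp : s ;; do_lift D ;; p C = t ;; do_lift D ;; p C.
  by rewrite -!compA lift_p !compA; congr comp; apply: one_eq.
apply: (lift_mono (B := B)); rewrite fpair_add_lift //.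
rewrite -!compA -f_lin !compA !ppair_tpmap.
rewrite -do_fpair (fpair_add_lift (do_bundle D)); last exact: one_eq.
rewrite -{1}zero_add_zero tpair_plus // fpair_plus_nat //.
by rewrite !tpair_base lp.
Qed.

(** Additivity for tangent vectors: apply [T] to additivity at the generic
    point of [(C * C) * Y]. *)
Lemma linear_left_T_add (Z : X) (s t : Z ~> T C) (y : Z ~> T Y) :
  tpair (tpair s t ;; Tm (do_add D)) y ;; Tm f =
  fpair (TSquare (sq B)) (tpair s y ;; Tm f) (tpair t y ;; Tm f) ;; Tm (add B).
Proof.
pose s0 : (C ** C) ** Y ~> C := cfst ;; cfst.
pose t0 : (C ** C) ** Y ~> C := cfst ;; csnd.
pose w := tpair (tpair s t) y.
have e : ppair s0 csnd ;; f ;; q = ppair t0 csnd ;; f ;; q.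
  by rewrite -!compA f_q !compA !ppair1.
have ws : w ;; Tm s0 = s by rewrite fmapM compA !tpair_fst.
have wt : w ;; Tm t0 = t by rewrite fmapM compA tpair_fst tpair_snd.
have wst : w ;; Tm (ppair s0 t0) = tpair s t by rewrite tpair_T_ppair ws wt.
have := congr1 (fun g => w ;; Tm g) (linear_left_add s0 t0 csnd).
rewrite !fmapM !compA tpair_T_ppair fmapM compA wst tpair_snd => ->.
by rewrite comp_T_fpair // !fmapM !compA !tpair_T_ppair ws wt tpair_snd.
Qed.
End LinearLeftTheory.
End CartesianLemmas.

(** * Uniform motion on a differential curve object *)

Section CurveLemmas.
Variables (X : CartesianTangentCategory) (C : DifferentialCurveObject X).
Notation D := (dco_diff C).

Lemma unit_curve : c0 C ;; c1 C = unit C ;; lambdaC C.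
Proof.
have c1p : c1 C ;; p C = idm C := curve_field (dco_curve C).
apply: (phat_ext (D := D)).
  rewrite -compA c1p -[RHS]compA lift_p compm1 compA dco_zero.
  by rewrite (one_eq (_ ;; bang C) (idm one)) comp1m.
by rewrite -[RHS]compA lift_phat compm1.
Qed.

(** The vector field [c1] has constant value [u]. *)
Lemma curve_constant : c1 C =
  tpair (zero C) (bang C ;; unit C ;; lambdaC C) ;; Tm (do_add D).
Proof.
have c1p : c1 C ;; p C = idm C := curve_field (dco_curve C).
have -> : tpair (zero C) (bang C ;; unit C ;; lambdaC C) =
    fpair (TSquare (do_square C)) (zero C) (bang C ;; unit C ;; lambdaC C).
  by apply: T_prod_ext; rewrite ?tpair_fst ?tpair_snd ?tpair0 ?tpair1.
apply: (phat_ext (D := D)).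
  rewrite tpair_p c1p zero_p -!compA lift_p !compA do_add_comm.
  by rewrite do_zero_add.
rewrite tpair_phat zero_phat do_zero_add -[RHS]compA lift_phat compm1.
exact: dco_unit.
Qed.

Section Bundle.
Variables (A M : X) (q : A ~> M) (B : DifferentialBundle q).
Notation l := (db_lift B).
Notation E := (Exp C B).

(** A map linear in its first variable solves the equation of uniform motion,
    with velocity its value at the unit. *)
Lemma linear_left_solution (Y : X) (f : C ** Y ~> A) (k : Y ~> M) :
  LinearLeft (lambdaC C) l f -> f ;; q = csnd ;; k ->
  let h := ppair (bang Y ;; unit C) (idm Y) ;; f in
  IsSolution (c1 C) (c0 C) (translation B)
    (fpair (sq B) (k ;; zer B) h) (fpair (sq B) f (csnd ;; h)).
Proof.
move=> f_lin f_q h.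
have hq : h ;; q = k by rewrite /h -compA f_q compA ppair1 comp1m.
have fh : f ;; q = csnd ;; h ;; q by rewrite f_q -compA hq.
split.
  rewrite comp_fpair // dco_zero (linear_left_zero (D := D) f_lin f_q).
  by rewrite compA ppair1 comp1m.
(* By additivity of [f], as [c1] is the sum of zero and [u lambda]. *)
have tf : tpmap (c1 C) (zero Y) ;; Tm f =
    fpair (TSquare (sq B)) (f ;; zero A) (csnd ;; h ;; l) ;; Tm (add B).
  have -> : tpmap (c1 C) (zero Y) =
      tpair (tpair (cfst ;; zero C) (csnd ;; (bang Y ;; unit C ;; lambdaC C))
        ;; Tm (do_add D)) (csnd ;; zero Y).
    rewrite tpmapE curve_constant compA comp_tpair.
    by rewrite !compA (one_eq (cfst ;; bang C) (csnd ;; bang Y)).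
  rewrite (linear_left_T_add (D := D) f_lin f_q) tpair_zero.
  rewrite ppair_id comp1m -zero_nat; congr (fpair _ _ _ ;; _).
  rewrite /h -!compA -f_lin !compA; congr comp.
  by rewrite comp_ppair ppair_tpmap compm1 !compA.
clearbody h.
apply: (Tfs_ext (B := B)); rewrite -!compA -fmapM ?fpair0 ?fpair1 //.
  rewrite Tfpair0; last exact: translation_compat.
  by rewrite fpair_mu.
rewrite Tfpair1; last by rewrite translation_compat.
rewrite fmapM compA tpmap_snd -compA -zero_nat !compA fpair1 // compA.
Qed.

(** A map that is linear in its first variable, over a given map [k], is
    determined by its value at the unit, by uniqueness of solutions of the
    equation of uniform motion. *)
Lemma linear_left_unique (Y : X) (f g : C ** Y ~> A) (k : Y ~> M) :
  LinearLeft (lambdaC C) l f -> LinearLeft (lambdaC C) l g ->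
  f ;; q = csnd ;; k -> g ;; q = csnd ;; k ->
  ppair (bang Y ;; unit C) (idm Y) ;; f = ppair (bang Y ;; unit C) (idm Y) ;; g ->
  f = g.
Proof.
move=> f_lin g_lin f_q g_q e.
have := linear_left_solution f_lin f_q; rewrite /= e => sf.
have /= sg := linear_left_solution g_lin g_q.
have := curve_unique (dco_curve C) (translation_field B) sf sg.
set h := _ ;; g.
have hq : h ;; q = k by rewrite /h -compA g_q compA ppair1 comp1m.
move/(congr1 (fun w => w ;; pr0 (sq B))); rewrite !fpair0 //.
  by rewrite g_q -compA hq.
by rewrite f_q -compA hq.
Qed.

(** * The exponential and the action *)

(** The exponential is linear in its second variable: both sides solve the
    vector field [T Delta c] on [T A] with initial value [l]. *)
Lemma Exp_linear : tpmap (zero C) l ;; Tm E = E ;; l.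
Proof.
have [E0 E1] := Exp_solution C B.
have [Dp _ _ Dl] := Delta_linear B.
have Vp : IsVectorField (Tm (Delta B) ;; flip A).
  by rewrite /IsVectorField -compA flip_p -fmapM Dp fmap1.
apply: (curve_unique (dco_curve C) Vp (g := l)); split.
- rewrite compA ppair_tpmap.
  have -> : tpair (bang A ;; c0 C ;; zero C) (idm A ;; l) =
      l ;; Tm (ppair (bang A ;; c0 C) (idm A)).
    rewrite tpair_T_ppair fmap1 comp1m compm1; congr tpair.
    rewrite fmapM !compA -compA zero_nat compA; congr comp; exact: T_one_eq.
  by rewrite -compA -fmapM E0 fmap1 compm1.
- rewrite fmapM compA -tpmap_interchange -!compA -flip_nat.
  by rewrite (compA (Tm (tpmap _ _))) -fmapM E1 fmapM !compA.
- by rewrite compA E0 comp1m.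
- rewrite fmapM compA E1 -(compA E) -(compA E) (compA l) Dl.
  by rewrite -(compA _ (flip A)) flip_flip compm1.
Qed.

Notation gam := (action C B).
Notation dE := (tpmap (lambdaC C) (zero A) ;; Tm E).

Lemma action_bracketP : IsBracket B dE gam.
Proof.
by rewrite /action /bracket; case: constructive_indefinite_description => h [].
Qed.

(** At time [c0] the exponential is the identity, so its derivative at [(t, a)]
    is a tangent vector at [a]. *)
Lemma dExp_p : dE ;; p A = csnd.
Proof.
have [E0 _] := Exp_solution C B.
rewrite -compA p_nat compA tpmapE tpair_base -!compA lift_p zero_p compm1.
have -> : ppair (cfst ;; (bang C ;; do_zero D)) csnd =
    csnd ;; ppair (bang A ;; c0 C) (idm A) :> (C ** A ~> _).
  rewrite comp_ppair compm1 dco_zero !compA.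
  by rewrite (one_eq (cfst ;; bang C) (csnd ;; bang A)).
by rewrite -compA E0 compm1.
Qed.

Lemma action_q : gam ;; q = csnd ;; q.
Proof. by have [<- _] := action_bracketP; rewrite dExp_p. Qed.

Lemma action_mu : fpair (sq B) csnd gam ;; mu B l = dE.
Proof. by have [_] := action_bracketP; rewrite dExp_p. Qed.

Lemma action_unit : ppair (bang A ;; unit C) (idm A) ;; gam = idm A.
Proof.
have [E0 E1] := Exp_solution C B.
set i := ppair _ _.
have i1 : i ;; csnd = idm A by rewrite ppair1.
have e : i ;; csnd ;; q = i ;; gam ;; q by rewrite -!compA action_q.
have e1 : idm A ;; q = i ;; gam ;; q by rewrite -e i1.
apply/esym/(fpair_mu_inj (B := B) (a := idm A)) => //.
rewrite -[in RHS]i1 -comp_fpair ?action_q // -[RHS]compA action_mu.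
rewrite compA /i ppair_tpmap -(compA (bang A)) -unit_curve compA.
by rewrite -ppair_tpmap -compA E1 compA E0 comp1m.
Qed.

Lemma action_unit_at (Y : X) (z : Y ~> one) (y : Y ~> A) :
  ppair (z ;; unit C) y ;; gam = y.
Proof.
have := congr1 (fun w => y ;; w) action_unit.
move: (unit C) => u; rewrite compA comp_ppair compA !compm1.
by rewrite (one_eq (y ;; bang A) z).
Qed.

Lemma action_linear_left : LinearLeft (lambdaC C) l gam.
Proof.
have e : csnd ;; q = gam ;; q by rewrite action_q.
have e0 : csnd ;; zero A ;; Tm q = tpmap (lambdaC C) (zero A) ;; Tm gam ;; Tm q.
  by rewrite -(compA (tpmap _ _)) -fmapM action_q fmapM compA tpmap_snd.
apply: (Tfpair_mu_inj (B := B) (a := csnd ;; zero A)) => //.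
  exact: fpair_mu_compat.
rewrite -fpair_mu_ell // action_mu -(tpmap_snd (lambdaC C) _) -comp_T_fpair //.
rewrite -[LHS]compA -fmapM.
rewrite action_mu -[RHS]compA ell_nat [RHS]compA tpmap_ell ?fmapM ?compA //.
exact: do_lift_lift.
Qed.

Lemma action_linear_right : tpmap (zero C) l ;; Tm gam = gam ;; l.
Proof.
have e : csnd ;; q = gam ;; q by rewrite action_q.
have e0 : csnd ;; l ;; Tm q = tpmap (zero C) l ;; Tm gam ;; Tm q.
  by rewrite -(compA (tpmap _ _)) -fmapM action_q fmapM compA tpmap_snd.
apply: (Tfpair_mu_inj (B := B) (a := csnd ;; l)) => //.
  by rewrite -!compA lift_q !compA e.
rewrite -fpair_mu_T_lift_flip // action_mu -(tpmap_snd (zero C) _) -comp_T_fpair //.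
rewrite -[LHS]compA.
rewrite -fmapM action_mu fmapM [LHS]compA.
rewrite -(compA _ (Tm E)) -fmapM -Exp_linear fmapM compA -tpmap_interchange.
by rewrite -(compA _ (flip _)) -flip_nat -!compA flip_flip compm1.
Qed.
End Bundle.

(** * Associativity and commutativity *)

(** Reparameterizing the second variable preserves linearity in the first. *)
Lemma linear_left_comp (Y Z A : X) (lA : A ~> T A) (f : C ** Z ~> A) (g : Y ~> Z) :
  LinearLeft (lambdaC C) lA f -> LinearLeft (lambdaC C) lA (pmap (idm C) g ;; f).
Proof.
move=> fl; rewrite /LinearLeft fmapM compA tpmapE tpair_T_pmap fmap1 compm1.
by rewrite -!compA -zero_nat -fl /pmap compm1 !compA ppair_tpmap -compA.
Qed.

Notation mul := (action C (bundleC C)).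

Lemma action_assoc (A M : X) (q : A ~> M) (B : DifferentialBundle q) :
  pmap (idm C) (action C B) ;; action C B =
  passoc C C A ;; pmap mul (idm A) ;; action C B.
Proof.
apply: (linear_left_unique (B := B) (k := csnd ;; q)).
- exact/linear_left_comp/action_linear_left.
- have mul_lin := action_linear_left (bundleC C).
  have passoc_lin : tpmap (lambdaC C) (zero (C ** A)) ;; Tm (passoc C C A) =
      tpair (ppair cfst (csnd ;; cfst) ;; tpmap (lambdaC C) (zero C))
        (csnd ;; csnd ;; zero A).
    rewrite /passoc !tpair_T_ppair ppair_tpmap.
    by rewrite !fmapM !compA tpmap_fst tpmap_snd -!compA !zero_nat.
  rewrite /LinearLeft -[RHS]compA -action_linear_left !fmapM !compA; congr comp.
  rewrite passoc_lin tpair_T_pmap fmap1 compm1 -compA mul_lin compA.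
  by rewrite /passoc ppair_pmap compm1 ppair_tpmap.
- by rewrite -compA action_q compA ppair1 -!compA action_q compA.
- by rewrite -!compA action_q !(compA (pmap _ _)) ppair1 compm1 compA ppair1 compA.
- rewrite [LHS]compA ppair_pmap !compm1 comp1m action_unit_at -ppair_id.
  rewrite [RHS]compA [X in _ = X ;; _]compA ppair_passoc ppair_pmap.
  by rewrite action_unit_at compm1 ppair_id comp1m.
Qed.

(** The unit is neutral on the right, because [x |-> x * u] and the identity
    are linear and agree at [u]. *)
Lemma mul_unit_right : pmap (idm C) (unit C) ;; mul = cfst.
Proof.
apply: (linear_left_unique (B := bundleC C) (k := idm one)).
- exact/linear_left_comp/action_linear_left.
- exact: tpmap_fst.
- exact: one_eq.
- exact: one_eq.
rewrite compA ppair_pmap ppair0 compm1 comp1m.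
rewrite action_unit_at.
by rewrite (one_eq (bang one) (idm one)) comp1m.
Qed.

Lemma mul_comm : pswap C C ;; mul = mul.
Proof.
apply: (linear_left_unique (B := bundleC C) (k := bang C)).
- rewrite /LinearLeft -compA -(action_linear_right (bundleC C)) fmapM !compA.
  by rewrite tpair_T_ppair !tpmap_fst !tpmap_snd ppair_tpmap.
- exact: (action_linear_left (bundleC C)).
- exact: one_eq.
- exact: one_eq.
rewrite action_unit [LHS]compA /pswap comp_ppair ppair0 ppair1.
have := congr1 (fun w => ppair (idm C) (bang C) ;; w) mul_unit_right.
by rewrite compA ppair_pmap ppair0 comp1m.
Qed.
End CurveLemmas.

Theorem theorem5p39 (X : CartesianTangentCategory) (C : DifferentialCurveObject X) :
  IsCommutativeDifferentialRig (lambdaC C) (action C (bundleC C)) (unit C) /\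
  forall (A M : X) (q : A ~> M) (B : DifferentialBundle q),
    IsDifferentialModule (lambdaC C) (action C (bundleC C)) (unit C) B (action C B).
Proof.
split; first split.
- split; [exact: action_unit | exact: mul_comm |].
  by rewrite -action_assoc.
- exact: (action_linear_left C (bundleC C)).
- exact: (action_linear_right C (bundleC C)).
move=> A M q B; split.
- exact: action_unit.
- exact: action_assoc.
- split; last by rewrite -action_linear_right.
  by rewrite action_q ppair1.
- split; first exact: action_q.
  by rewrite -action_linear_left.
Qed.
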